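(* Up to isomorphism, the dihedral group $D_{16}$ of order $16$ is the only finite non-abelian $2$-group $G$ that possesses a cyclic maximal subgroup and satisfies $\alpha(G)=\frac{3}{4}$.
   Context: For a finite group $G$, $L_1(G)$ denotes the set (poset) of cyclic subgroups of $G$ (including the trivial subgroup), and $\alpha(G)=\frac{|L_1(G)|}{|G|}$. *)

(* Defs.v *)
From mathcomp Require Import all_boot all_order all_algebra.
From mathcomp Require Import all_fingroup all_solvable.

Set Implicit Arguments.
Unset Strict Implicit.
Unset Printing Implicit Defensive.

Import GroupScope.

Definition cyclic_subgroups (gT : finGroupType) (G : {group gT}) :
  {set {group gT}} := [set H in subgroups G | cyclic H].

Definition alpha (gT : finGroupType) (G : {group gT}) : rat :=
  (#|cyclic_subgroups G|%:R / #|G|%:R)%R.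

(* Main.v *)
Require Import Defs.
From mathcomp Require Import all_boot all_order all_algebra.
From mathcomp Require Import all_fingroup all_solvable.
From mathcomp Require Import zify.

Set Implicit Arguments.
Unset Strict Implicit.
Unset Printing Implicit Defensive.

Import GroupScope.

(** Let G be a group of order 2 ^ n with a cyclic subgroup X of index 2, and
    c(G) its number of cyclic subgroups, so that alpha G = 3/4 reads
    4 * c(G) = 3 * 2 ^ n. The cyclic subgroups inside X are all the subgroups
    of X, and there are n of them. The others are the <[t]> with t in G \ X; as
    t and t^-1 generate the same group, their number d satisfies
      i <= d   and   2 * d <= 2 ^ n.-1 + i,
    where i is the number of involutions outside X (lemmas
    card_outer_involutions_le and card_cycles_outside_le).

    If y is one of these involutions, the others are the z * y with z in
    K = {z in X | z ^ y = z^-1}, a subgroup since X is abelian. Either K = X and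
    G is dihedral, or K has index at least 2 in X and 2 * i <= 2 ^ n.-1.

    In the dihedral case i = 2 ^ n.-1, hence c(G) = n + 2 ^ n.-1, and
    4 * c(G) = 3 * 2 ^ n amounts to n = 2 ^ n.-2, whose only solution n > 1 is
    n = 4. Otherwise 4 * c(G) <= 4 * n + 3 * 2 ^ n.-1, which is less than
    3 * 2 ^ n for n > 3. At n = 3 the two are equal, and the abelian group
    Z_4 x Z_2 does satisfy alpha = 3/4; but if G is not abelian, y acts
    nontrivially on X of order 4, that is by inversion, so i = 0 unless G is
    dihedral. *)

(** * Counting images and subgroups *)

(** A fibre of f meeting A contains t and g t for some t in A: it has two
    points, or one point which is fixed by g and is thus counted twice on the
    right-hand side. *)
Lemma leq_double_card_imset (T T' : finType) (A : {set T}) (f : T -> T')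
    (g : T -> T) :
    {in A, forall t, g t \in A} -> {in A, forall t, f (g t) = f t} ->
  2 * #|f @: A| <= #|A| + #|[set t in A | g t == t]|.
Proof.
move=> gA fg.
have card_fibers (B : {set T}) : B \subset A ->
    #|B| = \sum_(u in f @: A) #|[set t in B | f t == u]|.
  move=> sBA; rewrite -sum1_card (partition_big f (mem (f @: A))) /=.
    by apply: eq_bigr => u _; rewrite -sum1_card; apply: eq_bigl => t; rewrite inE.
  by move=> t Bt; rewrite imset_f ?(subsetP sBA).
rewrite (card_fibers A) // (card_fibers [set t in A | g t == t]); last first.
  by apply/subsetP=> t /setIdP[].
rewrite -big_split /= mulnC -sum_nat_const; apply: leq_sum => _ /imsetP[t At ->].
set F := [set s in A | _]; set F' := [set s in _ | _].
have Ft : t \in F by rewrite inE At eqxx.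
have [gt | gt] := eqVneq (g t) t.
  have F't : t \in F' by rewrite !inE At gt !eqxx.
  (* t itself is a point of the fibre and a fixed point in it. *)
  by apply: (@leq_add 1 1); rewrite card_gt0; apply/set0Pn; exists t.
apply: leq_trans (leq_addr _ _); rewrite -(_ : #|[set t; g t]| = 2).
  by apply/subset_leq_card/subsetP=> s /set2P[] ->; rewrite // !inE gA ?fg ?eqxx.
by rewrite cards2 eq_sym gt.
Qed.

(** A subgroup of a cyclic group is determined by its order, here a divisor of
    p ^ k. *)
Lemma card_subgroups_cyclic_pgroup (gT : finGroupType) (X : {group gT}) p k :
  prime p -> cyclic X -> #|X| = (p ^ k)%N -> #|subgroups X| = k.+1.
Proof.
move=> p_pr /cyclicP[x defX] oX; have p_gt1 := prime_gt1 p_pr.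
have ox : #[x] = (p ^ k)%N by rewrite -oX defX.
have oxp i : i <= k -> #|<[x ^+ (p ^ i)]>| = (p ^ (k - i))%N.
  by move=> le_ik; rewrite -orderE orderXdiv ox ?dvdn_exp2l // -expnB // prime_gt0.
pose f (i : 'I_k.+1) := <[x ^+ (p ^ i)]>%G.
have f_inj : injective f.
  move=> i j /(congr1 (fun H : {group gT} => #|H|)) /=.
  rewrite !oxp ?leq_ord // => /eqP; rewrite eqn_exp2l // => /eqP ij.
  by apply/val_inj => /=; have := ltn_ord i; have := ltn_ord j; lia.
rewrite -[RHS]card_ord -cardsT -(card_imset _ f_inj); apply: eq_card => H.
rewrite inE; apply/idP/imsetP=> [sHX | [i _ ->]]; last first.
  by rewrite /= defX cycle_subG mem_cycle.
have /(dvdn_pfactor _ _ p_pr)[j le_jk oH] : #|H| %| p ^ k by rewrite -oX cardSg.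
have lt_kj : k - j < k.+1 by rewrite ltnS leq_subr.
exists (Ordinal lt_kj); rewrite // /f; apply/group_inj/eqP => /=.
rewrite (@eq_subG_cyclic _ X) ?oxp ?leq_subr ?subKn ?oH //.
  by rewrite defX cycle_cyclic.
by rewrite defX cycle_subG mem_cycle.
Qed.

Lemma invg_eq_order2 (gT : finGroupType) (t : gT) :
  t != 1 -> (t^-1 == t) = (#[t] == 2).
Proof.
move=> nt_t; rewrite eq_invg_mul -[t * t]/(t ^+ 2).
apply/eqP/eqP=> [t2 | <-]; [exact: nt_prime_order | exact: expg_order].
Qed.

(** * Groups of order 2 ^ n with a cyclic subgroup of index 2 *)

Definition outer_involutions (gT : finGroupType) (G X : {set gT}) : {set gT} :=
  [set t in G :\: X | #[t] == 2].

Definition cycles_of (gT : finGroupType) (A : {set gT}) : {set {group gT}} :=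
  [set <[t]>%G | t in A].

Section CyclicIndexTwo.

Variables (gT : finGroupType) (G X : {group gT}) (n : nat).
Hypotheses (n_gt0 : n > 0) (oG : #|G| = (2 ^ n)%N).
Hypotheses (cycX : cyclic X) (sXG : X \subset G) (iXG : #|G : X| = 2).

Lemma card_index2 : #|X| = (2 ^ n.-1)%N.
Proof. by rewrite -(divg_indexS sXG) iXG oG -(prednK n_gt0) expnS mulKn. Qed.

Lemma card_outside_index2 : #|G :\: X| = (2 ^ n.-1)%N.
Proof.
have := cardsID X G; rewrite (setIidPr sXG) card_index2 oG.
have -> : (2 ^ n = 2 * 2 ^ n.-1)%N by rewrite -expnS prednK.
by rewrite mul2n -addnn => /addnI.
Qed.

Lemma card_cyclic_subgroups_split :
  #|cyclic_subgroups G| = n + #|cycles_of (G :\: X)|.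
Proof.
rewrite -(cardsID (subgroups X) (cyclic_subgroups G)); congr (_ + _)%N.
  rewrite -[RHS](prednK n_gt0).
  rewrite -(card_subgroups_cyclic_pgroup _ cycX card_index2) //.
  apply: eq_card => H; rewrite !inE; apply/idP/idP=> [/andP[] // | sHX].
  by rewrite sHX (subset_trans sHX) ?(cyclicS sHX).
apply: eq_card => H; rewrite !inE; apply/idP/imsetP.
  case/and3P=> notXH sHG /cyclicP[t defH]; exists t; last exact: group_inj.
  by rewrite inE -!cycle_subG -defH sHG notXH.
by case=> t /setDP[Gt notXt] ->; rewrite /= !cycle_subG Gt notXt cycle_cyclic.
Qed.

Lemma card_cycles_outside_le :
  2 * #|cycles_of (G :\: X)| <= 2 ^ n.-1 + #|outer_involutions G X|.
Proof.
have -> : outer_involutions G X = [set t in G :\: X | t^-1 == t].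
  apply/setP=> t; rewrite !inE; case: (boolP (t \in X)) => //= notXt.
  by rewrite invg_eq_order2 ?(group1_contra notXt).
rewrite -card_outside_index2; apply: leq_double_card_imset => t.
  by rewrite !inE !groupV.
by move=> _; apply: group_inj; rewrite /= cycleV.
Qed.

Lemma card_outer_involutions_le :
  #|outer_involutions G X| <= #|cycles_of (G :\: X)|.
Proof.
have inv_inj : {in outer_involutions G X &, injective (fun t => <[t]>%G)}.
  move=> s t /setIdP[/setDP[_ notXs] _] /setIdP[_ /eqP ot] /(congr1 val) /= eq_st.
  have: s \in <[t]> by rewrite -eq_st cycle_id.
  rewrite cycle2g // !inE => /orP[]/eqP // s1.
  by rewrite s1 group1 in notXs.
rewrite -(card_in_imset inv_inj) subset_leq_card //.
by apply: imsetS; apply/subsetP=> t /setIdP[].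
Qed.

Lemma mulg_cycle_outside_index2 t : t \in G :\: X -> X * <[t]> = G.
Proof.
case/setDP=> Gt notXt; apply: mulg_normal_maximal; rewrite ?cycle_subG //.
  exact: index2_normal.
by rewrite p_index_maximal ?iXG.
Qed.

Section Reflection.

Variable y : gT.
Hypothesis (Iy : y \in outer_involutions G X).

Definition inverted_by := [set z in X | z ^ y == z^-1].

(** Conjugation by y is a morphism, and so is inversion on the abelian group X;
    the set where they agree is a group. *)
Lemma group_set_inverted_by : group_set inverted_by.
Proof.
apply/group_setP; split=> [|s t]; first by rewrite inE group1 conj1g invg1 /=.
case/setIdP=> Xs /eqP sy /setIdP[Xt /eqP ty]; rewrite inE groupM //=.
rewrite conjMg sy ty invMg; apply/eqP.
by apply: (centsP (cyclic_abelian cycX)); rewrite groupV.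
Qed.

Canonical inverted_by_group := Group group_set_inverted_by.

(** Every element of G \ X is z * y with z in X, and (z * y)^-1 = y * z^-1 is
    equal to z * y exactly when y inverts z. *)
Lemma card_outer_involutions_inverted :
  #|outer_involutions G X| <= #|inverted_by|.
Proof.
have /setIdP[X'y oy] := Iy; have /setDP[_ notXy] := X'y.
have /eqP y2 : y^-1 == y by rewrite invg_eq_order2 ?(group1_contra notXy).
rewrite -(card_rcoset inverted_by y); apply/subset_leq_card/subsetP=> t.
case/setIdP=> X't; rewrite -invg_eq_order2; last first.
  by have /setDP[_ /group1_contra] := X't.
move: X't; rewrite -(rcoset_index2 sXG iXG X'y) => /rcosetP[z Xz ->].
rewrite invMg y2 => /eqP yz; apply/rcosetP; exists z => //.
by rewrite inE Xz conjgE -yz mulKg eqxx.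
Qed.

(** A generator x of X and y satisfy the relations of the dihedral presentation
    and generate G, which has the right order. *)
Lemma isog_dihedral_inverted :
  n > 1 -> X \subset inverted_by -> G \isog 'D_(2 ^ n).
Proof.
move=> n_gt1 sXK; have /cyclicP[x defX] := cycX.
have /setIdP[X'y /eqP oy] := Iy.
have /eqP xy : x ^ y == x^-1.
  have: x \in inverted_by by rewrite (subsetP sXK) // defX cycle_id.
  by case/setIdP.
have ox : #[x] = (2 ^ n.-1)%N by rewrite -card_index2 defX.
rewrite isogEcard card_2dihedral // oG leqnn andbT Grp_2dihedral //.
apply/existsP; exists (x, y); rewrite /= !xpair_eqE.
have := expg_order y; rewrite oy => ->.
rewrite -ox expg_order xy !eqxx !andbT.
rewrite norm_joinEr ?norms_cycle ?xy ?groupV ?cycle_id // -[X in X * _]defX.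
by rewrite mulg_cycle_outside_index2.
Qed.

Lemma card_outer_involutions_proper :
  ~~ (X \subset inverted_by) -> 2 * #|outer_involutions G X| <= #|X|.
Proof.
move=> not_sXK; have sKX : inverted_by \subset X.
  by apply/subsetP=> z /setIdP[].
have /= := Lagrange sKX; have := card_outer_involutions_inverted.
have : 1 < #|X : inverted_by| by rewrite indexg_gt1.
by move: #|X : _| #|_| #|inverted_by| #|X| => *; nia.
Qed.

(** The generator x of X has order 4, so its conjugate by y is x or x^-1; it is
    not x, because x and y generate the nonabelian group G. *)
Lemma inverted_by_order8 : ~~ abelian G -> n = 3 -> X \subset inverted_by.
Proof.
move=> not_cGG n3; have /cyclicP[x defX] := cycX.
have /setIdP[X'y _] := Iy; have /setDP[Gy notXy] := X'y.
have ox : #[x] = 4 by rewrite orderE -defX card_index2 n3.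
have nsXG := index2_normal sXG iXG.
suffices xy : x ^ y = x^-1.
  rewrite defX (_ : inverted_by = inverted_by_group) // cycle_subG inE xy eqxx.
  by rewrite defX cycle_id.
have: x ^ y \in <[x]>.
  by rewrite -defX memJ_norm ?defX ?cycle_id // -defX (subsetP (normal_norm nsXG)).
case/cyclePmin=> k; rewrite ox; case: k => [|[|[|[|//]]]] _ xy.
- by have := orderJ x y; rewrite xy order1 ox.
- case/negP: not_cGG.
  rewrite -(mulg_cycle_outside_index2 X'y) defX abelianM !cycle_abelian.
  rewrite cent_cycle cycle_subG /=; apply/cent1P/esym.
  by rewrite /commute conjgC xy expg1.
- by have := orderJ x y; rewrite xy orderXdiv ox.
by rewrite xy; apply/esym/eqP; rewrite eq_invg_mul -expgS -ox expg_order.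
Qed.

End Reflection.

Lemma outer_involutions_dichotomy :
    n > 1 -> ~ G \isog 'D_(2 ^ n) ->
  2 * #|outer_involutions G X| <= 2 ^ n.-1.
Proof.
move=> n_gt1 notD; rewrite -card_index2.
have [-> | [y Iy]] := set_0Vmem (outer_involutions G X); first by rewrite cards0.
apply: (card_outer_involutions_proper Iy); apply/negP=> sXK.
exact/notD/(isog_dihedral_inverted Iy).
Qed.

Lemma outer_involutions_order8 :
    ~~ abelian G -> ~ G \isog 'D_(2 ^ n) -> n = 3 ->
  #|outer_involutions G X| = 0.
Proof.
move=> not_cGG notD n3; apply/eqP; rewrite cards_eq0; apply/set0Pn=> -[y Iy].
by apply/notD/(isog_dihedral_inverted Iy); rewrite ?(inverted_by_order8 Iy) ?n3.
Qed.

(** For n = 3 the bound 2 * i <= 2 ^ n.-1 on the number i of involutions outside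
    X only gives 4 * c(G) <= 24 = 3 * 2 ^ 3; the strict inequality comes from
    i = 0. *)
Lemma card_cyclic_subgroups_not_dihedral :
    ~~ abelian G -> ~ G \isog 'D_(2 ^ n) ->
  4 * #|cyclic_subgroups G| < 3 * 2 ^ n.
Proof.
move=> not_cGG notD; have n_gt2 : n > 2.
  rewrite ltnNge; apply: contra not_cGG => n_le2.
  by rewrite (p2group_abelian (p := 2)) ?oG ?pfactorK // /pgroup oG pnatX.
have := card_cycles_outside_le; rewrite card_cyclic_subgroups_split.
have := outer_involutions_order8 not_cGG notD.
have := outer_involutions_dichotomy (ltnW n_gt2) notD.
move: #|_| #|_| => i d le_i n3 le_d.
have def2n : (2 ^ n = 2 * 2 ^ n.-1)%N by rewrite -expnS prednK.
(* The linear bound 4 * n + 3 * 2 ^ n.-1 < 3 * 2 ^ n holds only from n = 4 on. *)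
have [eq_n3 | gt_n3] : n = 3 \/ n > 3 by lia.
  by move: le_i le_d def2n; rewrite (n3 eq_n3) eq_n3; lia.
have lt_exp : (8 * n < 3 * 2 ^ n)%N.
  rewrite -(subnKC gt_n3); elim: (n - 4) => // m IHm.
  by rewrite addnS expnS; move: IHm; lia.
lia.
Qed.

End CyclicIndexTwo.

(** * Dihedral 2-groups *)

Lemma dihedral_cyclic_index2 (gT : finGroupType) (G : {group gT}) n :
    n > 1 -> G \isog 'D_(2 ^ n) ->
  exists X : {group gT}, [/\ cyclic X, X \subset G, #|G : X| = 2
    & {in G :\: X, forall t, #[t] = 2}].
Proof.
move=> n_gt1 isoG; have [[x y] genG _] := generators_2dihedral n_gt1 isoG.
have [[_ oX' _] _ _ _ _] := dihedral2_structure n_gt1 genG isoG.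
have [oG Gx ox _] := genG; have sXG : <[x]> \subset G by rewrite cycle_subG.
exists <[x]>%G; split=> //; first exact: cycle_cyclic.
rewrite -divgS // oG -orderE ox -{1}(prednK (ltnW n_gt1)) expnS mulnK //.
by rewrite expn_gt0.
Qed.

(** As every element outside X is an involution, the lower and upper bounds on
    the number of cyclic subgroups outside X coincide. *)
Lemma card_cyclic_subgroups_dihedral (gT : finGroupType) (G : {group gT}) n :
  n > 1 -> G \isog 'D_(2 ^ n) -> #|cyclic_subgroups G| = n + 2 ^ n.-1.
Proof.
move=> n_gt1 isoG; have n_gt0 := ltnW n_gt1.
have [X [cycX sXG iXG oX']] := dihedral_cyclic_index2 n_gt1 isoG.
have oG : #|G| = (2 ^ n)%N by rewrite (card_isog isoG) card_2dihedral.
rewrite (card_cyclic_subgroups_split n_gt0 oG cycX sXG iXG).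
have := card_cycles_outside_le n_gt0 oG sXG iXG.
have := card_outer_involutions_le G X.
suffices ->: outer_involutions G X = G :\: X.
  by rewrite (card_outside_index2 n_gt0 oG sXG iXG); lia.
apply/setP=> t; rewrite inE andb_idr // => X't.
by rewrite oX'.
Qed.

(** * Groups with alpha equal to 3/4 *)

Lemma alpha_eq_three_quarters (gT : finGroupType) (G : {group gT}) :
  alpha G = (3%:R / 4%:R)%R <-> (4 * #|cyclic_subgroups G| = 3 * #|G|)%N.
Proof.
have G_neq0 : (#|G|%:R : rat) != 0%R by rewrite Num.Theory.pnatr_eq0 -lt0n.
rewrite /alpha; split=> [/eqP | eq43].
  rewrite GRing.eqr_div // -!GRing.natrM Num.Theory.eqr_nat => /eqP.
  by rewrite mulnC.
by apply/eqP; rewrite GRing.eqr_div // -!GRing.natrM Num.Theory.eqr_nat mulnC eq43.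
Qed.

Theorem theorem3p7 (gT : finGroupType) (G : {group gT}) :
  [/\ 2.-group G, ~~ abelian G,
      (exists M : {group gT}, maximal M G /\ cyclic M)
    & alpha G = (3%:R / 4%:R)%R]
  <-> G \isog 'D_16.
Proof.
split=> [[pG not_cGG [X [maxX cycX]] /alpha_eq_three_quarters eq43] | isoG].
  have [n oG] := p_natP pG; have n_gt1 : n > 1.
    rewrite ltnNge; apply: contra not_cGG => n_le1.
    by rewrite (p2group_abelian pG) // oG pfactorK // (leq_trans n_le1).
  have sXG := maxgroupp maxX; rewrite oG in eq43.
  have iXG := p_maximal_index pG maxX.
  have [isoD | /negP notD] := boolP (G \isog 'D_(2 ^ n)); last first.
    have := card_cyclic_subgroups_not_dihedral (ltnW n_gt1) oG cycX
      (proper_sub sXG) iXG not_cGG notD.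
    by rewrite eq43 ltnn.
  suffices n4 : n = 4 by rewrite n4 in isoD.
  move: eq43; rewrite (card_cyclic_subgroups_dihedral n_gt1 isoD).
  (* It remains to solve 4 * n = 2 ^ n with n > 1. *)
  have [|] := ltnP n 5; first by case: (n) n_gt1 => [|[|[|[|[|?]]]]].
  move=> n_gt4.
  have lt_exp : (4 * n < 2 ^ n)%N.
    rewrite -(subnKC n_gt4); elim: (n - 5) => // m IHm.
    by rewrite addnS expnS; move: IHm; lia.
  have def2n : (2 ^ n = 2 * 2 ^ n.-1)%N by rewrite -expnS prednK // ltnW.
  lia.
have isoG4 : G \isog 'D_(2 ^ 4) by [].
have oG : #|G| = (2 ^ 4)%N by rewrite (card_isog isoG4) card_2dihedral.
have [X [cycX sXG iXG _]] := dihedral_cyclic_index2 (n := 4) isT isoG4.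
have pG : 2.-group G by rewrite /pgroup oG pnatX.
split=> //.
- have [[x y] genG _] := generators_2dihedral (n := 4) isT isoG4.
  have [_ [_ _ oG1 _] _ _ _] := dihedral2_structure (n := 4) isT genG isoG4.
  by apply/negP=> /derG1P G1; rewrite G1 cards1 in oG1.
- by exists X; rewrite p_index_maximal ?iXG.
by apply/alpha_eq_three_quarters; rewrite (card_cyclic_subgroups_dihedral _ isoG4) // oG.
Qed.
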